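(* Let $R>0$, let the local model $(\widetilde W,\omega_{can},S)$ carry the compatible holomorphic 2-form $\Omega=dZ_{\gamma_m}\wedge d\theta_{\gamma_e}+dZ_{\gamma_e}\wedge d\theta_{\gamma_m}=dz_1\wedge dz_2$ with complex structure $J_0=J_{au}$ (in particular $S$ is harmonic), and let $$\omega^{sf}=\pi R\cdot\mathrm{Re}(dZ_{\gamma_m}\wedge d\overline Z_{\gamma_e})+\frac1{2\pi R}\,d\theta_{\gamma_m}\wedge d\theta_{\gamma_e}$$ be the canonical semi-flat form on $\widetilde W_0$. Then $\omega^{sf}$ gives a hyperk\''ahler metric on $(\widetilde W_0,J_0)$ if and only if $S_1>\ln|c|$.
   Context: Local model. Let $0<\epsilon<1$, $B=\{c=c_1+ic_2\in\mathbb C:|c|<\epsilon\}$, $B_0=B\setminus\{0\}$. Let $S:\mathbb R^2\to\mathbb R$ be smooth with $S(0)=0$, regarded as a function of $c=(c_1,c_2)$, and $S_i=\partial S/\partial c_i$. Let $W=\mathbb C^2$ with coordinates $(z_1,z_2)$, $\omega_{can}=\mathrm{Re}(dz_1\wedge dz_2)$, $\pi_{can}(z_1,z_2)=z_1z_2=c$, with flows $\phi_1^t(z_1,z_2)=(e^tz_1,e^{-t}z_2)$, $\phi_2^t(z_1,z_2)=(e^{-it}z_1,e^{it}z_2)$. Let $\Pi_1=\{(c,1)\}$, $\Pi_2=\{(e^{S_1-iS_2},\,c\,e^{-S_1+iS_2})\}$, $|c|<\epsilon$. The space $\widetilde W$ is obtained from the part of $W$ over $B$ between the $\phi_2$-orbits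 $\phi_2(\Pi_1),\phi_2(\Pi_2)$ by gluing collar neighbourhoods of these orbits fibrewise via $\psi(z_1,z_2)=(e^{S_1(c)-iS_2(c)}z_2^{-1},\,e^{-S_1(c)+iS_2(c)}z_1z_2^2)$, $c=z_1z_2$. Put $\widetilde W_0=\pi_{can}^{-1}(B_0)$. $J_{au}$ is the complex structure with holomorphic coordinates $z_1,z_2$; it descends to $\widetilde W$ because $S$ is harmonic. Coordinates. $T(c;t_1,t_2)=(c\,e^{-t_1+it_2},e^{t_1-it_2})$ parametrizes $\widetilde W_0$ by $B_0\times\mathbb R^2$ modulo, over each $c$, $\langle (S_1-\ln|c|,S_2+\arg c),(0,2\pi)\rangle$. Holomorphic coordinates for $J_{au}$ on $\widetilde W_0$ are $u_1=c_1+ic_2$, $u_2=t_1-it_2$. With local branches of $\arg c$ and $\ln c=\ln|c|+i\arg c$ fixed, and $\widetilde S$ a harmonic conjugate of $S$ (so $S+i\widetilde S$ is holomorphic in $c$), $$Z_{\gamma_m}=\tfrac1{2\pi}[c-c\ln c+S+i\widetilde S],\quad Z_{\gamma_e}=-ic,\quad \theta_{\gamma_e}=\tfrac{2\pi t_1}{S_1-\ln|c|},\quad \theta_{\gamma_m}=t_2-\tfrac{S_2+\arg c}{S_1-\ln|c|}t_1$$ (the angle coordinates being defined where $S_1\neq\ln|c|$). One has $\Omega=dz_1\wedge dz_2=(dc_1+i\,dc_2)\wedge(dt_1-i\,dt_2)$. ''$\omega^{sf}$ gives a hyperk\''ahler metric on $(\widetilde W_0,J_0)$'' means that $\omega^{sf}$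 is a closed positive $(1,1)$-form with respect to $J_0$ (a K\''ahler form), which together with the holomorphic symplectic form $\Omega$ satisfies $\omega^{sf}\wedge\omega^{sf}=\frac12\Omega\wedge\overline\Omega$. The condition $S_1>\ln|c|$ is understood on $B_0$. *)

(* Defs.v *)
From HB Require Import structures.
From mathcomp Require Import all_boot all_order all_algebra.
From mathcomp Require Import complex.
From mathcomp Require Import all_classical all_reals all_analysis.

Set Implicit Arguments.
Unset Strict Implicit.
Unset Printing Implicit Defensive.

Import Order.TTheory GRing.Theory Num.Theory.
Import numFieldNormedType.Exports.

Local Open Scope classical_set_scope.
Local Open Scope ring_scope.
Local Open Scope complex_scope.

Section Smooth.
Context {K : realType} {V : normedModType K}.

Fixpoint Ck (k : nat) (U : set V) (f : V -> K) : Prop :=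
  if k is k'.+1 then
    (forall x, U x -> differentiable f x) /\
    (forall v : V, Ck k' U (fun x => 'D_v f x))
  else forall x, U x -> {for x, continuous f}.

(* Meaningful for open U. *)
Definition smooth_on (U : set V) (f : V -> K) : Prop := forall k, Ck k U f.

End Smooth.

(* A k-form at a point is a function of k tangent vectors; wedge products are
   sums over shuffles, so (a /\ b)(u, v) = a(u) b(v) - a(v) b(u). *)
Section Wedge.
Context {A : comPzRingType} {V : Type}.

Definition wedge (a b : V -> A) (u v : V) : A := a u * b v - a v * b u.

Definition wedge2 (w w' : V -> V -> A) (v1 v2 v3 v4 : V) : A :=
  w v1 v2 * w' v3 v4 - w v1 v3 * w' v2 v4 + w v1 v4 * w' v2 v3
  + w v2 v3 * w' v1 v4 - w v2 v4 * w' v1 v3 + w v3 v4 * w' v1 v2.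

End Wedge.

(* The base coordinate c = c1 + i c2 is the pair (c1, c2). *)
Notation plane K := (K * K)%type.
(* Points (c; t) of B_0 x R^2, and tangent vectors to it, in the coordinates
   ((c1, c2), (t1, t2)). *)
Notation wcover K := ((K * K) * (K * K))%type.

Section Forms.
Context {K : realType}.

Definition dR (f : wcover K -> K) (p v : wcover K) : K := 'D_v f p.

Definition dC (F : wcover K -> K[i]) (p v : wcover K) : K[i] :=
  'D_v (fun q => complex.Re (F q)) p +i* 'D_v (fun q => complex.Im (F q)) p.

Definition pullback (A : Type) (tau : wcover K -> wcover K)
    (w : wcover K -> wcover K -> wcover K -> A) (p u v : wcover K) : A :=
  w (tau p) ('D_u tau p) ('D_v tau p).

(* Exterior derivative of a 2-form; the Lie bracket terms vanish because
   u, v, w are extended to constant vector fields. *)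
Definition d2 (w : wcover K -> wcover K -> wcover K -> K)
    (p v1 v2 v3 : wcover K) : K :=
  'D_v1 (fun q => w q v2 v3) p - 'D_v2 (fun q => w q v1 v3) p
  + 'D_v3 (fun q => w q v1 v2) p.

End Forms.

Section LocalModel.
Context {K : realType}.
Implicit Types (c : plane K) (p : wcover K) (S St : plane K -> K).

Definition toC c : K[i] := c.1 +i* c.2.

(* The library norm on K * K is the max norm, hence this definition. *)
Definition cabs c : K := Num.sqrt (c.1 ^+ 2 + c.2 ^+ 2).

Definition expC (z : K[i]) : K[i] :=
  let: x +i* y := z in (expR x * cos y) +i* (expR x * sin y).

Definition B (eps : K) : set (plane K) := [set c | cabs c < eps].
Definition B0 (eps : K) : set (plane K) := B eps `\ (0, 0).

Definition pd1 S c : K := 'D_(1, 0) S c.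
Definition pd2 S c : K := 'D_(0, 1) S c.

Definition harmonic_on (U : set (plane K)) S : Prop :=
  forall c, U c -> pd1 (pd1 S) c + pd2 (pd2 S) c = 0.

(* S + i St is holomorphic on U (Cauchy-Riemann). *)
Definition harmonic_conjugate_on (U : set (plane K)) S St : Prop :=
  forall c, U c ->
    [/\ differentiable S c, differentiable St c,
        pd1 S c = pd2 St c & pd2 S c = - pd1 St c].

Definition arg_branch (c0 : plane K) (a : plane K -> K) : Prop :=
  \forall c \near c0, {for c, continuous a} /\
    toC c = (cabs c)%:C * expC (0 +i* a c).

Definition lnC (a : plane K -> K) c : K[i] := ln (cabs c) +i* a c.

(* The generator (S_1 - ln|c|, S_2 + arg c) of the fibre lattice; the other
   one is (0, 2 pi). *)
Definition period1 S c : K := pd1 S c - ln (cabs c).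
Definition period2 S (a : plane K -> K) c : K := pd2 S c + a c.

Definition W0 (eps : K) : set (wcover K) := [set p | B0 eps p.1].

Definition translate S (a : plane K -> K) p : wcover K :=
  (p.1, (p.2.1 + period1 S p.1, p.2.2 + period2 S a p.1)).
Definition translate_2pi p : wcover K := (p.1, (p.2.1, p.2.2 + 2 * pi)).

(* The map T, giving z1 and z2 in the coordinates (c; t). *)
Definition z1 p : K[i] := toC p.1 * expC ((- p.2.1) +i* p.2.2).
Definition z2 p : K[i] := expC (p.2.1 +i* (- p.2.2)).

(* J_au in the real coordinates underlying the holomorphic coordinates
   u1 = c1 + i c2 and u2 = t1 - i t2 (note the sign). *)
Definition Jau (v : wcover K) : wcover K :=
  ((- v.1.2, v.1.1), (v.2.2, - v.2.1)).

Definition Zm S St (a : plane K -> K) p : K[i] :=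
  ((2 * pi)^-1)%:C *
    (toC p.1 - toC p.1 * lnC a p.1 + (S p.1 +i* St p.1)).
Definition Ze p : K[i] := - (0 +i* 1) * toC p.1.
Definition theta_e S p : K := 2 * pi * p.2.1 / period1 S p.1.
Definition theta_m S (a : plane K -> K) p : K :=
  p.2.2 - period2 S a p.1 / period1 S p.1 * p.2.1.

Definition angles_defined S c : Prop := pd1 S c <> ln (cabs c).

(* In the next two definitions [arg c0] is the branch of arg chosen near c0. *)
Definition Omega_coord S St (arg : plane K -> plane K -> K)
    p (u v : wcover K) : K[i] :=
  let a := arg p.1 in
  wedge (dC (Zm S St a) p) (fun x => (dR (theta_e S) p x)%:C) u v
  + wedge (dC Ze p) (fun x => (dR (theta_m S a) p x)%:C) u v.

Definition omega_sf (R : K) S St (arg : plane K -> plane K -> K)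
    p (u v : wcover K) : K :=
  let a := arg p.1 in
  pi * R * complex.Re
    (wedge (dC (Zm S St a) p) (dC (fun q => conjc (Ze q)) p) u v)
  + (2 * pi * R)^-1 * wedge (dR (theta_m S a) p) (dR (theta_e S) p) u v.

(* Tensors on W~_0 are tensors on the cover B_0 x R^2 which are invariant under
   the fibrewise lattice translations. *)
Record hyperkahler_on_W0 (eps : K) S
    (Omega : wcover K -> wcover K -> wcover K -> K[i])
    (w : wcover K -> wcover K -> wcover K -> K) : Prop := {
  form_bilinear : forall p, W0 eps p -> forall u,
    (forall (k : K) v v', w p u (k *: v + v') = k * w p u v + w p u v');
  form_alternating : forall p, W0 eps p -> forall u v, w p u v = - w p v u;
  form_smooth : forall u v, smooth_on (W0 eps) (fun p => w p u v);
  form_descends : forall p, W0 eps p -> forall a, arg_branch p.1 a ->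
    forall u v, pullback (translate S a) w p u v = w p u v;
  form_descends_2pi : forall p, W0 eps p ->
    forall u v, pullback translate_2pi w p u v = w p u v;
  form_closed : forall p, W0 eps p ->
    forall v1 v2 v3, d2 w p v1 v2 v3 = 0;
  form_type11 : forall p, W0 eps p ->
    forall u v, w p (Jau u) (Jau v) = w p u v;
  form_positive : forall p, W0 eps p ->
    forall v, v != 0 -> 0 < w p v (Jau v);
  form_volume : forall p, W0 eps p -> forall v1 v2 v3 v4,
    (wedge2 (w p) (w p) v1 v2 v3 v4)%:C =
    2^-1 * wedge2 (Omega p) (fun x y => conjc (Omega p x y)) v1 v2 v3 v4
}.

End LocalModel.

(* Main.v *)
Require Import Defs.
From HB Require Import structures.
From mathcomp Require Import all_boot all_order all_algebra.
From mathcomp Require Import complex.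
From mathcomp Require Import all_classical all_reals all_analysis.
From mathcomp Require Import ring.

(* Put P = S_1 - ln|c|, Q = S_2 + arg c. Since S is harmonic, P - iQ is
   holomorphic in c and dZ_m = (P - iQ) dc / 2pi, whence, with
   eta = du_2 - (t_1 / P) d(P - iQ), a form of type (1,0) for J_au,
     omega^sf = R P dc_1 /\ dc_2 + (i / (2 R P)) eta /\ conj eta,
     Omega = dc /\ eta.
   The type, the volume identity, invariance under the lattice and closedness
   can be read off these formulas, and omega^sf(v, J v) =
   R P |dc(v)|^2 + |eta(v)|^2 / (R P) is positive exactly when P > 0. *)

Set Implicit Arguments.
Unset Strict Implicit.
Unset Printing Implicit Defensive.

Import Order.TTheory GRing.Theory Num.Theory.
Import numFieldNormedType.Exports.

Local Open Scope classical_set_scope.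
Local Open Scope ring_scope.
Local Open Scope complex_scope.

Section DiffCalculus.
Context {K : realType} {V W : normedModType K}.
Implicit Types (f g df dg : V -> K).

Lemma is_diffW (F dF dG : V -> W) x :
  is_diff x F dF -> dF =1 dG -> is_diff x F dG.
Proof. by move=> + /funext <-. Qed.

Lemma is_diff_derive (F dF : V -> W) x v : is_diff x F dF -> 'D_v F x = dF v.
Proof. by move=> [dfx <-]; rewrite deriveE. Qed.

Lemma near_is_diff (F G dF : V -> W) x :
  {near x, F =1 G} -> is_diff x F dF -> is_diff x G dF.
Proof.
move=> FG [Fx <-].
have FGx : F x = G x by exact: nbhs_singleton FG.
have lG : G \o shift x = cst (G x) + 'd F x +o_ 0 id.
  apply/eqaddoP => e e0; have /eqaddoP/(_ e e0) := diff_locally Fx.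
  move/nbhs0P: FG => FG; move: FG; apply: filterS2 => h /= FGh.
  by rewrite !fctE /= -FGx [h + x]addrC FGh.
have cF := diff_continuous (ex_diff (is_diff_def := differentiableP Fx)).
have dG := diff_unique cF lG.
have Gx : differentiable G x by apply/diff_locallyP; rewrite dG.
exact: DiffDef Gx dG.
Qed.

Lemma is_diff_add f g df dg x : is_diff x f df -> is_diff x g dg ->
  is_diff x (fun y => f y + g y) (fun v => df v + dg v).
Proof. exact: is_diffD. Qed.

Lemma is_diff_opp f df x : is_diff x f df ->
  is_diff x (fun y => - f y) (fun v => - df v).
Proof. exact: is_diffN. Qed.

Lemma is_diff_sub f g df dg x : is_diff x f df -> is_diff x g dg ->
  is_diff x (fun y => f y - g y) (fun v => df v - dg v).
Proof. exact: is_diffB. Qed.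

Lemma is_diff_mul f g df dg x : is_diff x f df -> is_diff x g dg ->
  is_diff x (fun y => f y * g y) (fun v => f x * dg v + g x * df v).
Proof. exact: is_diffM. Qed.

Lemma is_diff_const (a : W) x : is_diff x (fun _ : V => a) (fun=> 0).
Proof. exact: is_diff_cst. Qed.

Lemma is_diff_inv f df x : is_diff x f df -> f x != 0 ->
  is_diff x (fun y => (f y)^-1) (fun v => - (f x ^- 2 * df v)).
Proof.
move=> [dfx <-] fx0; apply: DiffDef; first exact: differentiableV.
by rewrite diffV //; apply/funext => v /=; rewrite scaleNr.
Qed.

Lemma is_diff_comp1 (h : K -> K) (dh : K) f df x :
  is_diff x f df -> is_derive (f x) 1 h dh ->
  is_diff x (fun y => h (f y)) (fun v => dh * df v).
Proof.
move=> fx [hx hE].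
have dhx : differentiable h (f x) by exact/derivable1_diffP.
have hd : is_diff (f x) h (fun k : K => k *: dh).
  by apply: DiffDef => //; rewrite diff1E // derive1E hE.
have H := is_diff_comp fx hd.
apply: DiffDef; first exact: (ex_diff (is_diff_def:=H)).
case: H => _ H; etransitivity; first exact: H.
by apply/funext => v /=; exact: mulrC.
Qed.

End DiffCalculus.

Section DiffProjections.
Context {K : realType} {U V1 V2 : normedModType K}.

Lemma is_diff_fst (F dF : U -> (V1 * V2)%type) x : is_diff x F dF ->
  is_diff x (fun y => (F y).1) (fun v => (dF v).1).
Proof.
move=> Fx.
have c1 : continuous (fst : (V1 * V2)%type -> V1) by move=> p; exact: cvg_fst.
have d1 : is_diff (F x) (fst : {linear (V1 * V2)%type -> V1}) fst.
  by apply: DiffDef; [exact: linear_differentiable | exact: diff_lin].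
exact: is_diff_comp Fx d1.
Qed.

Lemma is_diff_snd (F dF : U -> (V1 * V2)%type) x : is_diff x F dF ->
  is_diff x (fun y => (F y).2) (fun v => (dF v).2).
Proof.
move=> Fx.
have c2 : continuous (snd : (V1 * V2)%type -> V2) by move=> p; exact: cvg_snd.
have d2 : is_diff (F x) (snd : {linear (V1 * V2)%type -> V2}) snd.
  by apply: DiffDef; [exact: linear_differentiable | exact: diff_lin].
exact: is_diff_comp Fx d2.
Qed.

End DiffProjections.

Section Schwarz.
Context {K : realType} {V : normedModType K}.
Implicit Types (f : V -> K) (c u v : V).

Lemma line_MVT f c u (h : K) : (forall x, differentiable f x) -> 0 < h ->
  exists2 s, 0 < s < h & f (c + h *: u) - f c = h * 'D_u f (c + s *: u).
Proof.
move=> df h0.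
have dl (s : K) :
    is_derive s 1 (fun s : K => f (c + s *: u)) ('D_u f (c + s *: u)).
  have l : is_diff s (fun s : K => c + s *: u) (fun s : K => s *: u).
    have H := is_diffD (is_diff_cst c s) (is_diff_scalel s u).
    by apply: is_diffW H _ => k /=; rewrite add0r.
  have H := is_diff_comp l (differentiableP (df (c + s *: u))).
  apply: DeriveDef.
    by apply: diff_derivable; exact: (ex_diff (is_diff_def := H)).
  have -> := is_diff_derive (1 : K) H.
  by rewrite /= scale1r deriveE.
have cl : {within `[0, h], continuous (fun s : K => f (c + s *: u))}.
  apply: continuous_subspaceT => s.
  apply: differentiable_continuous; apply/derivable1_diffP.
  exact: (ex_derive (is_derive := dl s)).
have [s] := MVT h0 (fun x _ => dl x) cl.
rewrite in_itv /= => sh; rewrite scale0r addr0 subr0 mulrC => E.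
by exists s.
Qed.

Lemma second_difference f c u v (h : K) : (forall x, differentiable f x) ->
  (forall x, differentiable ('D_u f) x) -> 0 < h ->
  exists s t, [/\ 0 < s < h, 0 < t < h &
    f (c + h *: u + h *: v) - f (c + h *: u) - (f (c + h *: v) - f c)
    = h * (h * 'D_v ('D_u f) (c + s *: u + t *: v))].
Proof.
move=> df duf h0.
pose g x := f (x + h *: v) - f x.
have dg x : is_diff x g (fun w => 'd f (x + h *: v) w - 'd f x w).
  apply: is_diff_sub; last exact: differentiableP.
  have l : is_diff x (fun y => y + h *: v) id.
    have H := is_diffD (is_diff_id x) (is_diff_cst (h *: v) x).
    by apply: is_diffW H _ => k /=; rewrite addr0.
  exact: is_diff_comp l (differentiableP (df (x + h *: v))).
have [s sh E] := line_MVT c u (fun x => ex_diff (is_diff_def := dg x)) h0.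
have [t th E2] := line_MVT (c + s *: u) v duf h0.
exists s, t; split=> //.
move: E; rewrite /g => ->; rewrite (is_diff_derive u (dg _)) -!deriveE //.
by rewrite E2.
Qed.

Lemma schwarz f c u v : (forall x, differentiable f x) ->
  (forall x, differentiable ('D_u f) x) ->
  (forall x, differentiable ('D_v f) x) ->
  {for c, continuous ('D_v ('D_u f))} -> {for c, continuous ('D_u ('D_v f))} ->
  'D_v ('D_u f) c = 'D_u ('D_v f) c.
Proof.
move=> df du dv cF cG.
have small (F : V -> K) : {for c, continuous F} -> forall e, 0 < e ->
    exists2 d, 0 < d & forall w, `|w| < d -> `|F c - F (c + w)| < e.
  move=> /cvgrPdist_lt cc e /cc /nbhs0P /nbhs_norm0P [d /= d0 H].
  by exists d.
apply/eqP; rewrite -subr_eq0 -normr_eq0 eq_le normr_ge0 andbT.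
apply/ler_addgt0Pr => e e0; rewrite add0r.
have e20 : 0 < e / 2 by rewrite divr_gt0.
have [d1 d10 H1] := small _ cF _ e20.
have [d2 d20 H2] := small _ cG _ e20.
pose M : K := `|u| + `|v| + 1.
have M0 : 0 < M by rewrite ltr_wpDl // addr_ge0.
pose h : K := Num.min d1 d2 / M.
have h0 : 0 < h by rewrite divr_gt0 // lt_min d10.
have hM : h * M = Num.min d1 d2 by rewrite /h divfK // gt_eqF.
have bnd (s t : K) : 0 < s < h -> 0 < t < h ->
    forall x y : V, `|x| + `|y| + 1 = M -> `|s *: x + t *: y| < Num.min d1 d2.
  move=> /andP[s0 sh] /andP[t0 th] x y xy.
  rewrite -hM -xy; apply: le_lt_trans (ler_normD _ _) _.
  rewrite !normrZ (gtr0_norm s0) (gtr0_norm t0) !mulrDr mulr1.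
  rewrite -addrA ler_ltD // ?ler_wpM2r // 1?ltW //.
  by rewrite -[X in X < _]addr0 ler_ltD // ler_wpM2r // ltW.
have [s [t [sh th E]]] := second_difference c v df du h0.
have [s' [t' [sh' th' E']]] := second_difference c u df dv h0.
have B1 : `|s *: u + t *: v| < d1.
  have := bnd s t sh th u v erefl; rewrite lt_min; by case/andP.
have B2 : `|s' *: v + t' *: u| < d2.
  have E3 : `|v| + `|u| + 1 = M by rewrite /M [`|v| + _]addrC.
  have := bnd s' t' sh' th' v u E3; rewrite lt_min; by case/andP.
have FG : 'D_v ('D_u f) (c + s *: u + t *: v)
        = 'D_u ('D_v f) (c + s' *: v + t' *: u).
  apply: (mulfI (lt0r_neq0 h0)); apply: (mulfI (lt0r_neq0 h0)).
  refine (etrans (esym E) (etrans _ E')).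
  have -> : c + h *: v + h *: u = c + h *: u + h *: v.
    by rewrite -addrA (addrC (h *: v)) addrA.
  move: (f (c + h *: u)) (f (c + h *: v)) (f c) (f _) => x y z w; ring.
have := H1 (s *: u + t *: v); have := H2 (s' *: v + t' *: u).
rewrite !addrA FG => /[swap] /(_ B1) H1' /(_ B2) H2'.
rewrite -(subrKA ('D_u ('D_v f) (c + s' *: v + t' *: u))) (splitr e).
apply: le_trans (ler_normD _ _) _; apply: ltW; apply: ltrD.
  exact: H1'.
by rewrite distrC.
Qed.

End Schwarz.

Section SmoothCalculus.
Context {K : realType} {V : normedModType K} (U : set V) (oU : open U).
Implicit Types (f g : V -> K).

Lemma open_near_eq (T : Type) (f g : V -> T) x : {in U, f =1 g} -> U x ->
  {near x, f =1 g}.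
Proof.
move=> fg Ux; have : nbhs x U by exact: open_nbhs_nbhs.
by apply: filterS => y Uy; apply: fg; rewrite inE.
Qed.

Lemma Ck_eq k f g : {in U, f =1 g} -> Ck k U f -> Ck k U g.
Proof.
elim: k f g => [|k IH] f g fg /=.
  move=> cf x Ux; have fgx := open_near_eq fg Ux.
  have cfx : f @ x --> f x := cf x Ux.
  change (g @ x --> g x); rewrite -(fg x) ?inE //.
  by apply: cvg_trans cfx; apply: near_eq_cvg; move: fgx; apply: filterS.
move=> [df Dk]; split=> [x Ux|v].
  exact: (ex_diff (is_diff_def := near_is_diff (open_near_eq fg Ux)
    (differentiableP (df x Ux)))).
apply: IH (Dk v) => x; rewrite inE => Ux.
exact: near_eq_derive (open_near_eq fg Ux).
Qed.

Lemma Ck_pred k f : Ck k.+1 U f -> Ck k U f.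
Proof.
elim: k f => [|k IH] f [df Dk].
  by move=> x /df /differentiable_continuous.
by split=> // v; apply: IH.
Qed.

Lemma Ck_derive k f (L : V -> V -> K) :
  (forall x, U x -> is_diff x f (L x)) -> (forall v, Ck k U (L^~ v)) ->
  Ck k.+1 U f.
Proof.
move=> fL Lk; split=> [x /fL fx|v]; first exact: (ex_diff (is_diff_def := fx)).
apply: Ck_eq (Lk v) => x; rewrite inE => /fL fx.
by rewrite (is_diff_derive _ fx).
Qed.

Lemma Ck_is_diff k f x : Ck k.+1 U f -> U x ->
  is_diff x f (fun v => 'D_v f x).
Proof.
move=> [df _] Ux; apply: is_diffW (differentiableP (df x Ux)) _ => v.
by rewrite deriveE //; exact: df.
Qed.

Lemma Ck_const k (a : K) : Ck k U (fun=> a).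
Proof.
elim: k a => [|k IH] a; first by move=> x _; exact: cst_continuous.
exact: (@Ck_derive _ _ (fun _ _ => 0) (fun x _ => is_diff_const a x)
  (fun v => IH 0)).
Qed.

Lemma Ck_add k f g : Ck k U f -> Ck k U g -> Ck k U (fun x => f x + g x).
Proof.
elim: k f g => [|k IH] f g.
  by move=> cf cg x Ux; apply: continuousD; [exact: cf|exact: cg].
move=> fk gk.
apply: (@Ck_derive _ _ (fun x v => 'D_v f x + 'D_v g x)) => [x Ux|v].
  by apply: is_diff_add; apply: Ck_is_diff; eassumption.
exact: (IH _ _ (fk.2 v) (gk.2 v)).
Qed.

Lemma Ck_mul k f g : Ck k U f -> Ck k U g -> Ck k U (fun x => f x * g x).
Proof.
elim: k f g => [|k IH] f g.
  by move=> cf cg x Ux; apply: continuousM; [exact: cf|exact: cg].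
move=> fk gk.
apply: (@Ck_derive _ _ (fun x v => f x * 'D_v g x + g x * 'D_v f x))
  => [x Ux|v].
  by apply: is_diff_mul; apply: Ck_is_diff; eassumption.
exact: (Ck_add (IH _ _ (Ck_pred fk) (gk.2 v)) (IH _ _ (Ck_pred gk) (fk.2 v))).
Qed.

Lemma Ck_opp k f : Ck k U f -> Ck k U (fun x => - f x).
Proof.
move=> fk; apply: (Ck_eq _ (Ck_mul (Ck_const k (-1)) fk)) => x _ /=.
exact: mulN1r.
Qed.

Lemma Ck_inv k f : (forall x, U x -> f x != 0) -> Ck k U f ->
  Ck k U (fun x => (f x)^-1).
Proof.
move=> f0; elim: k => [|k IH].
  by move=> cf x Ux; apply: continuousV; [exact: f0|exact: cf].
move=> fk.
apply: (@Ck_derive _ _ (fun x v => - ((f x)^-1 * (f x)^-1 * 'D_v f x)))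
  => [x Ux|v].
  apply: is_diffW (is_diff_inv (Ck_is_diff fk Ux) (f0 x Ux)) _ => v.
  by rewrite expr2 invfM.
have ik := IH (Ck_pred fk).
exact: (Ck_opp (Ck_mul (Ck_mul ik ik) (fk.2 v))).
Qed.

Lemma smooth_eq f g : {in U, f =1 g} -> smooth_on U f -> smooth_on U g.
Proof. by move=> fg fk k; apply: Ck_eq fg (fk k). Qed.

Lemma smooth_const (a : K) : smooth_on U (fun=> a).
Proof. by move=> k; exact: Ck_const. Qed.

Lemma smooth_add f g : smooth_on U f -> smooth_on U g ->
  smooth_on U (fun x => f x + g x).
Proof. by move=> fk gk k; apply: Ck_add. Qed.

Lemma smooth_opp f : smooth_on U f -> smooth_on U (fun x => - f x).
Proof. by move=> fk k; apply: Ck_opp. Qed.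

Lemma smooth_mul f g : smooth_on U f -> smooth_on U g ->
  smooth_on U (fun x => f x * g x).
Proof. by move=> fk gk k; apply: Ck_mul. Qed.

Lemma smooth_inv f : (forall x, U x -> f x != 0) -> smooth_on U f ->
  smooth_on U (fun x => (f x)^-1).
Proof. by move=> f0 fk k; apply: Ck_inv. Qed.

Lemma smooth_derive f (L : V -> V -> K) :
  (forall x, U x -> is_diff x f (L x)) -> (forall v, smooth_on U (L^~ v)) ->
  smooth_on U f.
Proof.
move=> fL Lk [|k]; last by apply: Ck_derive fL _ => v; exact: Lk.
by apply: Ck_pred; apply: Ck_derive fL _ => v; exact: Lk.
Qed.

Lemma derive_smooth f v : smooth_on U f -> smooth_on U ('D_v f).
Proof. by move=> fk k; apply: (fk k.+1).2. Qed.

End SmoothCalculus.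

Lemma smooth_subset (K : realType) (V : normedModType K) (U U' : set V)
  (f : V -> K) : U' `<=` U -> smooth_on U f -> smooth_on U' f.
Proof.
move=> sU fk k; move: (fk k); elim: k f {fk} => [|k IH] f /=.
  by move=> cf x /sU; exact: cf.
by move=> [df Dk]; split=> [x /sU|v]; [exact: df|apply: IH].
Qed.

Lemma schwarz_smooth (K : realType) (V : normedModType K) (f : V -> K) c u v :
  smooth_on setT f -> 'D_v ('D_u f) c = 'D_u ('D_v f) c.
Proof.
move=> fk; apply: schwarz => [x|x|x||]; try exact: (fk 1).1.
- exact: (derive_smooth u fk 1).1.
- exact: (derive_smooth v fk 1).1.
- exact: (derive_smooth v (derive_smooth u fk) 0).
- exact: (derive_smooth u (derive_smooth v fk) 0).
Qed.

Section SmoothProjections.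
Context {K : realType} {V1 V2 : normedModType K}.
Implicit Types (U : set V1).

Lemma open_fst U : open U -> open [set p : (V1 * V2)%type | U p.1].
Proof.
move=> oU.
have c1 : {in [set p : (V1 * V2)%type | U p.1], continuous fst}.
  by move=> p _; exact: cvg_fst.
exact: open_comp c1 oU.
Qed.

Lemma smooth_fst U (f : V1 -> K) : open U -> smooth_on U f ->
  smooth_on [set p : (V1 * V2)%type | U p.1] (fun p => f p.1).
Proof.
move=> oU fk k; move: (fk k); elim: k f {fk} => [|k IH] f.
  move=> cf p Up; apply: continuous_comp; first exact: cvg_fst.
  exact: cf.
move=> fk; apply: (Ck_derive (open_fst oU) (L := fun p v => 'D_(v.1) f p.1)).
  move=> p Up.
  exact: is_diff_comp (is_diff_fst (is_diff_id p)) (Ck_is_diff fk Up).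
by move=> v; exact: (IH _ (fk.2 v.1)).
Qed.

End SmoothProjections.

Section PlaneLogarithm.
Context {K : realType}.
Implicit Types (c v x : plane K).

Lemma sqr_sum_gt0 c : c != (0, 0) -> 0 < c.1 ^+ 2 + c.2 ^+ 2.
Proof.
case: c => c1 c2 /= c0; rewrite lt_neqAle addr_ge0 ?sqr_ge0 // andbT eq_sym.
by rewrite paddr_eq0 ?sqr_ge0 // !sqrf_eq0.
Qed.

Lemma cabs_gt0 c : c != (0, 0) -> 0 < cabs c.
Proof. by move=> /sqr_sum_gt0 c0; rewrite sqrtr_gt0. Qed.

Lemma is_diff_coord1 c : is_diff c (fun x : plane K => x.1) (fun v => v.1).
Proof. exact: is_diff_fst (is_diff_id c). Qed.

Lemma is_diff_coord2 c : is_diff c (fun x : plane K => x.2) (fun v => v.2).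
Proof. exact: is_diff_snd (is_diff_id c). Qed.

Lemma is_diff_sqr_sum c :
  is_diff c (fun x : plane K => x.1 ^+ 2 + x.2 ^+ 2)
    (fun v => 2 * (c.1 * v.1 + c.2 * v.2)).
Proof.
have d1 := is_diff_coord1 c; have d2 := is_diff_coord2 c.
have dN := is_diff_add (is_diff_mul d1 d1) (is_diff_mul d2 d2).
apply: is_diffW dN _ => v; ring.
Qed.

Lemma sqr_sum_continuous c :
  {for c, continuous (fun x : plane K => x.1 ^+ 2 + x.2 ^+ 2)}.
Proof.
exact/differentiable_continuous/(ex_diff (is_diff_def := is_diff_sqr_sum c)).
Qed.

Lemma near_neq0 c : c != (0, 0) -> \forall x \near c, x != (0, 0).
Proof.
move=> /sqr_sum_gt0 N0; have P : \forall x \near c, 0 < x.1 ^+ 2 + x.2 ^+ 2.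
  exact: (cvgr_gt _ (@sqr_sum_continuous c) _ N0).
apply: filterS P => x Nx; apply/eqP => x0; move: Nx.
by rewrite x0 /= !expr0n /= addr0 ltxx.
Qed.

Lemma cabs_continuous c : {for c, continuous (@cabs K)}.
Proof.
exact: (@continuous_comp _ _ _ (fun x : plane K => x.1 ^+ 2 + x.2 ^+ 2) Num.sqrt
  c (@sqr_sum_continuous c) (@sqrt_continuous _ _)).
Qed.

Lemma near_B (eps : K) c : B eps c -> \forall x \near c, B eps x.
Proof. exact: (cvgr_lt _ (@cabs_continuous c)). Qed.

Lemma open_B0 (eps : K) : open (B0 eps).
Proof.
rewrite openE => c [cB /eqP c0]; rewrite /interior /=.
by apply: filterS2 (near_neq0 c0) (near_B cB) => x x0 xB; split => //;
  exact/eqP.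
Qed.

Lemma B0_neq0 (eps : K) c : B0 eps c -> c != (0, 0).
Proof. by move=> [_ /eqP]. Qed.

Lemma ln_cabs c : c != (0, 0) -> ln (cabs c) = 2^-1 * ln (c.1 ^+ 2 + c.2 ^+ 2).
Proof.
move=> c0; have N0 := sqr_sum_gt0 c0.
rewrite -[in RHS](@sqr_sqrtr _ (_ + _)) ?ltW // lnXn ?sqrtr_gt0 //.
by rewrite /cabs; field.
Qed.

Lemma is_diff_ln_cabs c : c != (0, 0) ->
  is_diff c (fun x => ln (cabs x))
    (fun v => (c.1 * v.1 + c.2 * v.2) / (c.1 ^+ 2 + c.2 ^+ 2)).
Proof.
move=> c0; have N0 := sqr_sum_gt0 c0.
have lnE : {near c, (fun x => 2^-1 * ln (x.1 ^+ 2 + x.2 ^+ 2)) =1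
    (fun x => ln (cabs x))}.
  by apply: filterS (near_neq0 c0) => x x0; rewrite ln_cabs.
apply: (near_is_diff lnE).
have dL := is_diff_comp1 (is_diff_sqr_sum c) (is_derive1_ln N0).
apply: is_diffW (is_diff_mul (is_diff_const (2^-1 : K) c) dL) _ => v /=.
by field; rewrite gt_eqF.
Qed.

Lemma arg_branchP c a : arg_branch c a ->
  {for c, continuous a} /\
  \forall x \near c, x.1 = cabs x * cos (a x) /\ x.2 = cabs x * sin (a x).
Proof.
move=> ab; split; first exact: (nbhs_singleton ab).1.
move: ab; apply: filterS => x [_].
rewrite /toC /expC /= expR0 !mul1r => /eqP; rewrite eq_complex /=.
by rewrite !mul0r subr0 addr0 => /andP[/eqP ? /eqP ?].
Qed.

Lemma is_diff_arg c a : c != (0, 0) -> arg_branch c a ->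
  is_diff c a (fun v => (c.1 * v.2 - c.2 * v.1) / (c.1 ^+ 2 + c.2 ^+ 2)).
Proof.
move=> c0 /arg_branchP[ca polar]; have N0 := sqr_sum_gt0 c0.
pose g x := (c.1 * x.2 - c.2 * x.1) / (c.1 * x.1 + c.2 * x.2).
have gc : g c = 0 by rewrite /g [c.1 * c.2]mulrC subrr mul0r.
have [c1E c2E] := nbhs_singleton polar.
have aE : {near c, (fun x => a c + atan (g x)) =1 a}.
  have pi20 : 0 < pi / 2 :> K by rewrite divr_gt0 // pi_gt0.
  have close : \forall x \near c, `|a c - a x| < pi / 2.
    by move/cvgrPdist_lt : ca; apply.
  near=> x.
  have x0 : x != (0, 0) by near: x; exact: near_neq0.
  have [x1E x2E] : x.1 = cabs x * cos (a x) /\ x.2 = cabs x * sin (a x).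
    by near: x.
  have D : - (pi / 2) < a x - a c < pi / 2.
    by rewrite -ltr_norml distrC; near: x.
  have cosD0 : cos (a x - a c) != 0 by rewrite gt_eqF // cos_gt0_pihalf.
  have -> : g x = tan (a x - a c).
    rewrite /g /tan sinB cosB; rewrite cosB in cosD0.
    have r0 := lt0r_neq0 (cabs_gt0 c0); have s0 := lt0r_neq0 (cabs_gt0 x0).
    rewrite x1E x2E c1E c2E; field.
    rewrite cosD0 /=.
    have -> : cabs c * cos (a c) * (cabs x * cos (a x)) +
        cabs c * sin (a c) * (cabs x * sin (a x)) =
      cabs c * cabs x * (cos (a x) * cos (a c) + sin (a x) * sin (a c)) by ring.
    by rewrite !mulf_neq0.
  by rewrite tanK ?in_itv //= addrC subrK.
apply: (near_is_diff aE).
have d1 := is_diff_coord1 c; have d2 := is_diff_coord2 c.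
have k1 := is_diff_const c.1 c; have k2 := is_diff_const c.2 c.
have N0' : c.1 * c.1 + c.2 * c.2 != 0 by rewrite gt_eqF.
have dg := is_diff_mul (is_diff_sub (is_diff_mul k1 d2) (is_diff_mul k2 d1))
  (is_diff_inv (is_diff_add (is_diff_mul k1 d1) (is_diff_mul k2 d2)) N0').
have H := is_diff_add (is_diff_const (a c) c)
  (is_diff_comp1 dg (is_derive1_atan _)).
 apply: is_diffW H _ => v /=.
rewrite -/(g c) gc.
by field; rewrite gt_eqF.
Unshelve. all: by end_near.
Qed.

End PlaneLogarithm.

Section PartialDerivatives.
Context {K : realType}.
Implicit Types (c : plane K) (p : wcover K) (f : plane K -> K).

Lemma is_diff_pd f c : differentiable f c ->
  is_diff c f (fun v => pd1 f c * v.1 + pd2 f c * v.2).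
Proof.
move=> df; apply: is_diffW (differentiableP df) _ => -[v1 v2] /=.
rewrite /pd1 /pd2 !deriveE //.
have -> : ((v1, v2) : plane K) =
    v1 *: ((1, 0) : plane K) + v2 *: ((0, 1) : plane K).
  apply: injective_projections => /=; rewrite scaler0 ?addr0 ?add0r.
    by rewrite -[LHS]mulr1.
  by rewrite -[LHS]mulr1.
rewrite linearD !linearZ /=; congr (_ + _); exact: mulrC.
Qed.

Lemma is_diff_base (W : normedModType K) (f df : plane K -> W) p :
  is_diff (p.1) f df -> is_diff p (fun q : wcover K => f q.1) (fun v => df v.1).
Proof. move=> fp; exact: is_diff_comp (is_diff_fst (is_diff_id p)) fp. Qed.

Lemma is_diff_t1 p : is_diff p (fun q : wcover K => q.2.1) (fun v => v.2.1).
Proof. exact: is_diff_fst (is_diff_snd (is_diff_id p)). Qed.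

Lemma is_diff_t2 p : is_diff p (fun q : wcover K => q.2.2) (fun v => v.2.2).
Proof. exact: is_diff_snd (is_diff_snd (is_diff_id p)). Qed.

Lemma smooth_t1 (U : set (wcover K)) : open U ->
  smooth_on U (fun q : wcover K => q.2.1).
Proof.
move=> oU.
exact: (smooth_derive oU (fun p _ => is_diff_t1 p)
  (fun v => smooth_const oU v.2.1)).
Qed.

Lemma smooth_coord1 (U : set (plane K)) : open U ->
  smooth_on U (fun c : plane K => c.1).
Proof.
move=> oU.
exact: (smooth_derive oU (L := fun _ v : plane K => v.1)
  (fun c _ => is_diff_coord1 c) (fun v => smooth_const oU (v.1 : K))).
Qed.

Lemma smooth_coord2 (U : set (plane K)) : open U ->
  smooth_on U (fun c : plane K => c.2).
Proof.
move=> oU.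
exact: (smooth_derive oU (L := fun _ v : plane K => v.2)
  (fun c _ => is_diff_coord2 c) (fun v => smooth_const oU (v.2 : K))).
Qed.

End PartialDerivatives.

Section PeriodDerivatives.
Context {K : realType} {eps : K} (S : plane K -> K).
Context (S_smooth : smooth_on setT S) (S_harmonic : harmonic_on (B eps) S).
Implicit Types (c : plane K).

Definition dlog1 c : K := c.1 / (c.1 ^+ 2 + c.2 ^+ 2).
Definition dlog2 c : K := c.2 / (c.1 ^+ 2 + c.2 ^+ 2).
Definition period1_1 c : K := pd1 (pd1 S) c - dlog1 c.
Definition period1_2 c : K := pd2 (pd1 S) c - dlog2 c.
Definition period1_11 c : K := pd1 (pd1 (pd1 S)) c
  - (c.2 ^+ 2 - c.1 ^+ 2) / (c.1 ^+ 2 + c.2 ^+ 2) ^+ 2.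
Definition period1_12 c : K := pd2 (pd1 (pd1 S)) c
  + 2 * c.1 * c.2 / (c.1 ^+ 2 + c.2 ^+ 2) ^+ 2.

Lemma pd_smooth f : smooth_on setT f ->
  smooth_on setT (@pd1 K f) /\ smooth_on setT (@pd2 K f).
Proof. by move=> fk; split; apply: derive_smooth. Qed.

Lemma smooth_differentiable f c : smooth_on setT f -> differentiable f c.
Proof. by move=> fk; apply: (fk 1).1. Qed.

Lemma is_diff_smooth f c : smooth_on setT f ->
  is_diff c f (fun v => pd1 f c * v.1 + pd2 f c * v.2).
Proof. by move=> fk; apply/is_diff_pd/smooth_differentiable. Qed.

Lemma pd_comm f : smooth_on setT f ->
  pd1 (pd2 f) = pd2 (pd1 f) :> (plane K -> K).
Proof. by move=> fk; apply/funext => c; apply: schwarz_smooth. Qed.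

Lemma is_diff_period1 c : c != (0, 0) ->
  is_diff c (period1 S) (fun v => period1_1 c * v.1 + period1_2 c * v.2).
Proof.
move=> c0.
have H := is_diff_sub (is_diff_smooth c (pd_smooth S_smooth).1)
  (is_diff_ln_cabs c0).
apply: is_diffW H _ => v; rewrite /period1_1 /period1_2 /dlog1 /dlog2; ring.
Qed.

(* Harmonicity makes [S_1 - ln|c|] and [S_2 + arg c] satisfy, up to sign, the
   Cauchy-Riemann equations. *)
Lemma is_diff_period2 c a : B0 eps c -> arg_branch c a ->
  is_diff c (period2 S a) (fun v => period1_2 c * v.1 - period1_1 c * v.2).
Proof.
move=> cB /is_diff_arg -/(_ (B0_neq0 cB)) da.
have H := is_diff_add (is_diff_smooth c (pd_smooth S_smooth).2) da.
apply: is_diffW H _ => v; rewrite /period1_1 /period1_2 /dlog1 /dlog2.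
rewrite pd_comm //; have := S_harmonic cB.1.
move=> /(canRL (addKr _)) ->; rewrite addr0; ring.
Qed.

Lemma is_diff_period1_1 c : c != (0, 0) ->
  is_diff c period1_1 (fun v => period1_11 c * v.1 + period1_12 c * v.2).
Proof.
move=> c0; have N0 := lt0r_neq0 (sqr_sum_gt0 c0).
have [S1 _] := pd_smooth S_smooth; have [S11 _] := pd_smooth S1.
have H := is_diff_sub (is_diff_smooth c S11)
  (is_diff_mul (is_diff_coord1 c) (is_diff_inv (is_diff_sqr_sum c) N0)).
apply: is_diffW H _ => v; rewrite /period1_11 /period1_12 /=; field.
exact: N0.
Qed.

Lemma laplacian_pd1 c : B eps c -> pd2 (pd2 (pd1 S)) c = - pd1 (pd1 (pd1 S)) c.
Proof.
move=> cB; have [S1 S2] := pd_smooth S_smooth; have [_ S22] := pd_smooth S2.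
rewrite -pd_comm // -pd_comm //.
have E : \forall x \near c, pd1 (pd1 S) x = - pd2 (pd2 S) x.
  apply: filterS (near_B cB) => x /S_harmonic.
  by move/eqP; rewrite addr_eq0 => /eqP.
have E1 : pd1 (pd1 (pd1 S)) c = 'D_(1, 0) (fun x => - pd2 (pd2 S) x) c.
  exact: near_eq_derive E.
have E2 := deriveN (diff_derivable (v := (1, 0) : plane K)
  (smooth_differentiable c S22)).
exact: esym (etrans (congr1 -%R (etrans E1 E2)) (opprK _)).
Qed.

Lemma is_diff_period1_2 c : B0 eps c ->
  is_diff c period1_2 (fun v => period1_12 c * v.1 - period1_11 c * v.2).
Proof.
move=> cB; have c0 := B0_neq0 cB; have N0 := lt0r_neq0 (sqr_sum_gt0 c0).
have [S1 _] := pd_smooth S_smooth; have [_ S12] := pd_smooth S1.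
have E1 : pd1 (pd2 (pd1 S)) c = pd2 (pd1 (pd1 S)) c.
  exact: schwarz_smooth S1.
have E2 := laplacian_pd1 cB.1.
have H1 : is_diff c (pd2 (pd1 S))
    (fun v => pd2 (pd1 (pd1 S)) c * v.1 - pd1 (pd1 (pd1 S)) c * v.2).
  apply: is_diffW (is_diff_smooth c S12) _ => v.
  exact: (congr2 +%R (congr1 ( *%R^~ v.1) E1)
    (etrans (congr1 ( *%R^~ v.2) E2) (mulNr _ _))).
have H := is_diff_sub H1
  (is_diff_mul (is_diff_coord2 c) (is_diff_inv (is_diff_sqr_sum c) N0)).
apply: is_diffW H _ => v; rewrite /period1_11 /period1_12 /=.
move: (pd2 _ c) (pd1 _ c) => A A'.
by field; exact: N0.
Qed.

Lemma smooth_dlog : smooth_on (B0 eps) dlog1 /\ smooth_on (B0 eps) dlog2.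
Proof.
have oB := @open_B0 K eps.
have s1 := smooth_coord1 oB; have s2 := smooth_coord2 oB.
have sN := smooth_inv oB (f := fun c : plane K => c.1 ^+ 2 + c.2 ^+ 2)
  (fun c cB => lt0r_neq0 (sqr_sum_gt0 (B0_neq0 cB)))
  (smooth_add oB (smooth_mul oB s1 s1) (smooth_mul oB s2 s2)).
by split; apply: smooth_mul.
Qed.

Lemma smooth_period1_1 : smooth_on (B0 eps) period1_1.
Proof.
have [S1 _] := pd_smooth S_smooth; have [S11 _] := pd_smooth S1.
have oB := @open_B0 K eps.
exact: (smooth_add oB (smooth_subset (@subsetT _ _) S11)
  (smooth_opp oB smooth_dlog.1)).
Qed.

Lemma smooth_period1_2 : smooth_on (B0 eps) period1_2.
Proof.
have [S1 _] := pd_smooth S_smooth; have [_ S12] := pd_smooth S1.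
have oB := @open_B0 K eps.
exact: (smooth_add oB (smooth_subset (@subsetT _ _) S12)
  (smooth_opp oB smooth_dlog.2)).
Qed.

Lemma smooth_period1 : smooth_on (B0 eps) (period1 S).
Proof.
have oB := @open_B0 K eps.
apply: (smooth_derive oB (fun c cB => is_diff_period1 (B0_neq0 cB))) => v.
apply: (smooth_add oB); apply: (smooth_mul oB); try exact: smooth_const.
  exact: smooth_period1_1.
exact: smooth_period1_2.
Qed.

End PeriodDerivatives.

Section SemiFlatFormula.
Context {K : realType} {eps : K} (S St : plane K -> K).
Context (arg : plane K -> plane K -> K).
Context (S_smooth : smooth_on setT S) (S_harmonic : harmonic_on (B eps) S).
Context (St_conj : harmonic_conjugate_on (B eps) S St).
Context (arg_local : forall c0, B0 eps c0 -> arg_branch c0 (arg c0)).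
Implicit Types (p u v : wcover K).

(* [etaR - i etaI] is the horizontal (1,0)-form
   [du_2 - (t_1 / P) d(P - i Q)], where [P = S_1 - ln|c|], [Q = S_2 + arg c]. *)
Definition etaR p u : K := u.2.1 - p.2.1 / period1 S p.1 *
  (period1_1 S p.1 * u.1.1 + period1_2 S p.1 * u.1.2).
Definition etaI p u : K := u.2.2 - p.2.1 / period1 S p.1 *
  (period1_2 S p.1 * u.1.1 - period1_1 S p.1 * u.1.2).

Definition semi_flat (R : K) p u v : K :=
  R * period1 S p.1 * (u.1.1 * v.1.2 - u.1.2 * v.1.1)
  + (R * period1 S p.1)^-1 * (etaI p u * etaR p v - etaR p u * etaI p v).

Lemma W0_neq0 p : W0 eps p -> p.1 != (0, 0).
Proof. exact: B0_neq0. Qed.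

Lemma dR_theta_e p v : W0 eps p -> period1 S p.1 != 0 ->
  dR (theta_e S) p v = 2 * pi / period1 S p.1 * etaR p v.
Proof.
move=> pW P0.
have dP := is_diff_base (is_diff_period1 S_smooth (W0_neq0 pW)).
have H := is_diff_mul
  (is_diff_mul (is_diff_const (2 * pi : K) p) (is_diff_t1 p))
  (is_diff_inv dP P0).
rewrite /dR (is_diff_derive v H) /etaR /=.
by field; exact: P0.
Qed.

Lemma dR_theta_m p v a : W0 eps p -> arg_branch p.1 a -> period1 S p.1 != 0 ->
  dR (theta_m S a) p v =
  etaI p v - period2 S a p.1 / period1 S p.1 * etaR p v.
Proof.
move=> pW pa P0.
have dP := is_diff_base (is_diff_period1 S_smooth (W0_neq0 pW)).
have dQ := is_diff_base (is_diff_period2 S_smooth S_harmonic pW pa).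
have H := is_diff_sub (is_diff_t2 p)
  (is_diff_mul (is_diff_mul dQ (is_diff_inv dP P0)) (is_diff_t1 p)).
rewrite /dR (is_diff_derive v H) /etaR /etaI /=.
by field; exact: P0.
Qed.

Lemma dC_eq (F : wcover K -> K[i]) (f g df dg : wcover K -> K) p v :
  (forall q, F q = f q +i* g q) -> is_diff p f df -> is_diff p g dg ->
  dC F p v = df v +i* dg v.
Proof.
move=> /funext -> fp gp; rewrite /dC /=.
by rewrite (is_diff_derive v fp) (is_diff_derive v gp).
Qed.

Lemma is_diff_c1 p : is_diff p (fun q : wcover K => q.1.1) (fun v => v.1.1).
Proof. exact: is_diff_fst (is_diff_fst (is_diff_id p)). Qed.

Lemma is_diff_c2 p : is_diff p (fun q : wcover K => q.1.2) (fun v => v.1.2).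
Proof. exact: is_diff_snd (is_diff_fst (is_diff_id p)). Qed.

Lemma dC_Ze p v : dC (@Ze K) p v = v.1.2 +i* - v.1.1.
Proof.
apply: (dC_eq v _ (is_diff_c2 p) (is_diff_opp (is_diff_c1 p))) => q.
by rewrite /Ze /toC; apply/eqP; rewrite eq_complex /=; apply/andP; split;
  apply/eqP; ring.
Qed.

Lemma dC_conj_Ze p v : dC (fun q => conjc (@Ze K q)) p v = v.1.2 +i* v.1.1.
Proof.
apply: (dC_eq v _ (is_diff_c2 p) (is_diff_c1 p)) => q.
by rewrite /Ze /toC; apply/eqP; rewrite eq_complex /=; apply/andP; split;
  apply/eqP; ring.
Qed.

Lemma dC_Zm p v a : W0 eps p -> arg_branch p.1 a ->
  dC (Zm S St a) p v =
  (2 * pi)^-1 * (period1 S p.1 * v.1.1 + period2 S a p.1 * v.1.2) +i*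
  ((2 * pi)^-1 * (period1 S p.1 * v.1.2 - period2 S a p.1 * v.1.1)).
Proof.
move=> pW pa; have c0 := W0_neq0 pW; have N0 := lt0r_neq0 (sqr_sum_gt0 c0).
have [dS dSt E1 E2] := St_conj pW.1.
have d1 := is_diff_c1 p; have d2 := is_diff_c2 p.
have dL := is_diff_base (is_diff_ln_cabs c0).
have dA := is_diff_base (is_diff_arg c0 pa).
have dSp := is_diff_base (is_diff_pd dS).
have dStp := is_diff_base (is_diff_pd dSt).
have k := is_diff_const ((2 * pi)^-1 : K) p.
have HR := is_diff_mul k (is_diff_add
  (is_diff_sub d1 (is_diff_sub (is_diff_mul d1 dL) (is_diff_mul d2 dA))) dSp).
have HI := is_diff_mul k (is_diff_add
  (is_diff_sub d2 (is_diff_add (is_diff_mul d1 dA) (is_diff_mul d2 dL))) dStp).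
rewrite (dC_eq v _ HR HI).
  rewrite -E1 /period1 /period2 E2.
  have pi0 : pi != 0 :> K by rewrite gt_eqF // pi_gt0.
  move: (pi) pi0 => w pi0; congr (_ +i* _).
    by field; rewrite pi0 N0.
  by field; rewrite pi0 N0.
move=> q; apply/eqP; rewrite eq_complex /=; apply/andP; split; apply/eqP; ring.
Qed.

Lemma omega_sfE R p u v : R != 0 -> W0 eps p -> period1 S p.1 != 0 ->
  omega_sf R S St arg p u v = semi_flat R p u v.
Proof.
move=> R0 pW P0; have pa := arg_local pW.
rewrite /omega_sf /wedge !dC_Zm // !dC_conj_Ze !dR_theta_e // !dR_theta_m //.
rewrite /semi_flat /=.
have pi0 : pi != 0 :> K by rewrite gt_eqF // pi_gt0.
move: (pi) pi0 => w pi0.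
move: (etaR p u) (etaR p v) (etaI p u) (etaI p v) => a b c d.
move: (period2 S _ _) P0; move: (period1 S _) => P Q P0.
by field; rewrite ?R0 ?P0 ?pi0.
Qed.

Lemma Omega_coordE p u v : W0 eps p -> period1 S p.1 != 0 ->
  Omega_coord S St arg p u v =
  wedge (fun w => toC w.1) (fun w => etaR p w +i* - etaI p w) u v.
Proof.
move=> pW P0; have pa := arg_local pW.
rewrite /Omega_coord /wedge !dC_Zm // !dC_Ze !dR_theta_e // !dR_theta_m //.
have pi0 : pi != 0 :> K by rewrite gt_eqF // pi_gt0.
move: (pi) pi0 => w pi0.
move: (etaR p u) (etaR p v) (etaI p u) (etaI p v) => a b c d.
move: (period2 S _ _) P0; move: (period1 S _) => P Q P0.
apply/eqP; rewrite eq_complex /=; apply/andP; split; apply/eqP.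
  by field; rewrite ?P0 ?pi0.
by field; rewrite ?P0 ?pi0.
Qed.

End SemiFlatFormula.

Section Hyperkahler.
Context {K : realType} {eps R : K} {S : plane K -> K}.
Context (S_smooth : smooth_on setT S) (S_harmonic : harmonic_on (B eps) S).
Context (R0 : 0 < R) (P_gt0 : forall c, B0 eps c -> 0 < period1 S c).
Implicit Types (p u v w : wcover K).

Local Notation P p := (period1 S p.1).
Local Notation dP p u :=
  (period1_1 S p.1 * u.1.1 + period1_2 S p.1 * u.1.2).
Local Notation dQ p u :=
  (period1_2 S p.1 * u.1.1 - period1_1 S p.1 * u.1.2).

Lemma P_neq0 p : W0 eps p -> P p != 0.
Proof. by move=> /P_gt0 /lt0r_neq0. Qed.

Lemma open_W0 : open (W0 eps).
Proof. exact: open_fst (@open_B0 K eps). Qed.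

Lemma etaR_linear p (k : K) v v' :
  etaR S p (k *: v + v') = k * etaR S p v + etaR S p v'.
Proof.
have -> : etaR S p (k *: v + v') = (k * v.2.1 + v'.2.1) - p.2.1 / P p *
  (period1_1 S p.1 * (k * v.1.1 + v'.1.1)
   + period1_2 S p.1 * (k * v.1.2 + v'.1.2)).
  by [].
by rewrite /etaR; ring.
Qed.

Lemma etaI_linear p (k : K) v v' :
  etaI S p (k *: v + v') = k * etaI S p v + etaI S p v'.
Proof.
have -> : etaI S p (k *: v + v') = (k * v.2.2 + v'.2.2) - p.2.1 / P p *
  (period1_2 S p.1 * (k * v.1.1 + v'.1.1)
   - period1_1 S p.1 * (k * v.1.2 + v'.1.2)).
  by [].
by rewrite /etaI; ring.
Qed.

Lemma etaR_Jau p v : etaR S p (Jau v) = etaI S p v.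
Proof. by rewrite /etaR /etaI /Jau /=; ring. Qed.

Lemma etaI_Jau p v : etaI S p (Jau v) = - etaR S p v.
Proof. by rewrite /etaR /etaI /Jau /=; ring. Qed.

Lemma semi_flat_linear p u (k : K) v v' :
  semi_flat S R p u (k *: v + v') =
  k * semi_flat S R p u v + semi_flat S R p u v'.
Proof.
rewrite /semi_flat etaR_linear etaI_linear.
have -> : (k *: v + v').1.1 = k * v.1.1 + v'.1.1 by [].
have -> : (k *: v + v').1.2 = k * v.1.2 + v'.1.2 by [].
ring.
Qed.

Lemma semi_flat_Jau p v : semi_flat S R p v (Jau v) =
  R * P p * (v.1.1 ^+ 2 + v.1.2 ^+ 2)
  + (R * P p)^-1 * (etaR S p v ^+ 2 + etaI S p v ^+ 2).
Proof. by rewrite /semi_flat etaR_Jau etaI_Jau /Jau /=; ring. Qed.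

Lemma semi_flat_positive p v : W0 eps p -> v != 0 ->
  0 < semi_flat S R p v (Jau v).
Proof.
move=> pW v0; rewrite semi_flat_Jau.
have RP0 : 0 < R * P p by rewrite mulr_gt0 // P_gt0.
have [h|h] := eqVneq v.1 (0, 0); last first.
  apply: ltr_pwDl; first by rewrite mulr_gt0 // sqr_sum_gt0.
  by rewrite mulr_ge0 ?addr_ge0 ?sqr_ge0 // invr_ge0 ltW.
have h2 : v.2 != (0, 0).
  by apply: contraNneq v0 => h2; apply/eqP; apply: injective_projections.
have -> : etaR S p v = v.2.1 by rewrite /etaR h /= !mulr0 addr0 mulr0 subr0.
have -> : etaI S p v = v.2.2 by rewrite /etaI h /= !mulr0 subr0 mulr0 subr0.
rewrite h /= expr0n /= addr0 mulr0 add0r.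
by rewrite mulr_gt0 ?invr_gt0 // sqr_sum_gt0.
Qed.

Lemma semi_flat_type11 p u v :
  semi_flat S R p (Jau u) (Jau v) = semi_flat S R p u v.
Proof. by rewrite /semi_flat !etaR_Jau !etaI_Jau /Jau /=; ring. Qed.

Lemma is_diff_P p : W0 eps p ->
  is_diff p (fun q : wcover K => P q) (fun w => dP p w).
Proof.
move=> pW; exact: is_diff_base (is_diff_period1 S_smooth (W0_neq0 pW)).
Qed.

Lemma is_diff_etaR p u : W0 eps p -> is_diff p (fun q => etaR S q u)
  (fun w => - (etaR S p w / P p * dP p u + p.2.1 / P p *
    ((period1_11 S p.1 * w.1.1 + period1_12 S p.1 * w.1.2) * u.1.1 +
     (period1_12 S p.1 * w.1.1 - period1_11 S p.1 * w.1.2) * u.1.2))).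
Proof.
move=> pW; have P0 := P_neq0 pW.
have d1 := is_diff_base (is_diff_period1_1 S_smooth (W0_neq0 pW)).
have d2 := is_diff_base (is_diff_period1_2 S_smooth S_harmonic pW).
have H := is_diff_sub (is_diff_const u.2.1 p) (is_diff_mul
  (is_diff_mul (is_diff_t1 p) (is_diff_inv (is_diff_P pW) P0))
  (is_diff_add (is_diff_mul d1 (is_diff_const u.1.1 p))
               (is_diff_mul d2 (is_diff_const u.1.2 p)))).
apply: is_diffW H _ => w; rewrite /etaR /=.
by field; exact: P0.
Qed.

Lemma is_diff_etaI p u : W0 eps p -> is_diff p (fun q => etaI S q u)
  (fun w => - (etaR S p w / P p * dQ p u + p.2.1 / P p *
    ((period1_12 S p.1 * w.1.1 - period1_11 S p.1 * w.1.2) * u.1.1 -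
     (period1_11 S p.1 * w.1.1 + period1_12 S p.1 * w.1.2) * u.1.2))).
Proof.
move=> pW; have P0 := P_neq0 pW.
have d1 := is_diff_base (is_diff_period1_1 S_smooth (W0_neq0 pW)).
have d2 := is_diff_base (is_diff_period1_2 S_smooth S_harmonic pW).
have H := is_diff_sub (is_diff_const u.2.2 p) (is_diff_mul
  (is_diff_mul (is_diff_t1 p) (is_diff_inv (is_diff_P pW) P0))
  (is_diff_sub (is_diff_mul d2 (is_diff_const u.1.1 p))
               (is_diff_mul d1 (is_diff_const u.1.2 p)))).
apply: is_diffW H _ => w; rewrite /etaR /=.
by field; exact: P0.
Qed.

Lemma semi_flat_closed p v1 v2 v3 : W0 eps p ->
  d2 (semi_flat S R) p v1 v2 v3 = 0.
Proof.
move=> pW; have P0 := P_neq0 pW; have Rn0 := lt0r_neq0 R0.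
have RP0 : R * P p != 0 by rewrite mulf_neq0.
have dRP := is_diff_mul (is_diff_const R p) (is_diff_P pW).
have H u v := is_diff_add
  (is_diff_mul dRP (is_diff_const (u.1.1 * v.1.2 - u.1.2 * v.1.1) p))
  (is_diff_mul (is_diff_inv dRP RP0)
    (is_diff_sub (is_diff_mul (is_diff_etaI u pW) (is_diff_etaR v pW))
                 (is_diff_mul (is_diff_etaR u pW) (is_diff_etaI v pW)))).
rewrite /d2 /semi_flat !(is_diff_derive _ (H _ _)).
move: (etaR S p v1) (etaR S p v2) (etaR S p v3) => a1 a2 a3.
move: (etaI S p v1) (etaI S p v2) (etaI S p v3) => b1 b2 b3.
move: (period1_1 S _) (period1_2 S _) (period1_11 S _) (period1_12 S _) => *.
by field; rewrite P0 Rn0.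
Qed.

Lemma smooth_P : smooth_on (W0 eps) (fun q => P q).
Proof. exact: smooth_fst (@open_B0 K eps) (smooth_period1 S_smooth). Qed.

Lemma smooth_eta u :
  smooth_on (W0 eps) (fun q => etaR S q u) /\
  smooth_on (W0 eps) (fun q => etaI S q u).
Proof.
have oW := open_W0; have oB := @open_B0 K eps.
have s1 := smooth_fst (V2 := plane K) oB
  (smooth_period1_1 (eps := eps) S_smooth).
have s2 := smooth_fst (V2 := plane K) oB
  (smooth_period1_2 (eps := eps) S_smooth).
have cst (k : K) := smooth_const oW k.
have sT := smooth_mul oW (smooth_t1 oW) (smooth_inv oW P_neq0 smooth_P).
split.
  exact: (smooth_add oW (cst u.2.1) (smooth_opp oW (smooth_mul oW sT
    (smooth_add oW (smooth_mul oW s1 (cst u.1.1))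
      (smooth_mul oW s2 (cst u.1.2)))))).
exact: (smooth_add oW (cst u.2.2) (smooth_opp oW (smooth_mul oW sT
  (smooth_add oW (smooth_mul oW s2 (cst u.1.1))
    (smooth_opp oW (smooth_mul oW s1 (cst u.1.2))))))).
Qed.

Lemma semi_flat_smooth u v : smooth_on (W0 eps) (fun p => semi_flat S R p u v).
Proof.
have oW := open_W0.
have [uR uI] := smooth_eta u; have [vR vI] := smooth_eta v.
have sRP := smooth_mul oW (smooth_const oW R) smooth_P.
have RP0 p : W0 eps p -> R * P p != 0.
  by move=> pW; rewrite mulf_neq0 ?P_neq0 // lt0r_neq0.
exact: (smooth_add oW (smooth_mul oW sRP (smooth_const oW _))
  (smooth_mul oW (smooth_inv oW RP0 sRP)
    (smooth_add oW (smooth_mul oW uI vR)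
      (smooth_opp oW (smooth_mul oW uR vI))))).
Qed.

Lemma semi_flat_descends p a u v : W0 eps p -> arg_branch p.1 a ->
  pullback (translate S a) (semi_flat S R) p u v = semi_flat S R p u v.
Proof.
move=> pW pa; have P0 := P_neq0 pW.
have H : is_diff p (translate S a)
    (fun w => (w.1, (w.2.1 + dP p w, w.2.2 + dQ p w))).
  have dQ' := is_diff_base (is_diff_period2 S_smooth S_harmonic pW pa).
  exact: is_diff_pair (is_diff_fst (is_diff_id p)) (is_diff_pair
    (is_diff_add (is_diff_t1 p) (is_diff_P pW))
    (is_diff_add (is_diff_t2 p) dQ')).
rewrite /pullback !(is_diff_derive _ H) /semi_flat /etaR /etaI /=.
move: (period1_1 S _) (period1_2 S _) => x y.
by field; rewrite P0 lt0r_neq0.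
Qed.

Lemma semi_flat_descends_2pi p u v :
  pullback (@translate_2pi K) (semi_flat S R) p u v = semi_flat S R p u v.
Proof.
have H : is_diff p (@translate_2pi K) (fun w => (w.1, (w.2.1, w.2.2 + 0))).
  exact: is_diff_pair (is_diff_fst (is_diff_id p)) (is_diff_pair
    (is_diff_t1 p) (is_diff_add (is_diff_t2 p) (is_diff_const (2 * pi : K) p))).
by rewrite /pullback !(is_diff_derive _ H) /semi_flat /etaR /etaI /= !addr0.
Qed.

Lemma semi_flat_volume p v1 v2 v3 v4 : W0 eps p ->
  let Om := wedge (fun w => toC w.1) (fun w => etaR S p w +i* - etaI S p w) in
  (wedge2 (semi_flat S R p) (semi_flat S R p) v1 v2 v3 v4)%:C =
  2^-1 * wedge2 Om (fun x y => conjc (Om x y)) v1 v2 v3 v4.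
Proof.
move=> pW Om; have P0 := P_neq0 pW; have Rn0 := lt0r_neq0 R0.
have -> : (2^-1 : K[i]) = (2^-1)%:C by rewrite fmorphV rmorph_nat.
rewrite /Om /wedge2 /wedge /semi_flat /toC; cbv beta.
move: (etaR S p v1) (etaR S p v2) (etaR S p v3) (etaR S p v4) => a1 a2 a3 a4.
move: (etaI S p v1) (etaI S p v2) (etaI S p v3) (etaI S p v4) => b1 b2 b3 b4.
clear Om; move: v1.1 v2.1 v3.1 v4.1 => [x1 y1] [x2 y2] [x3 y3] [x4 y4].
apply/eqP; rewrite eq_complex /=; apply/andP; split; apply/eqP.
  by field; rewrite P0 Rn0.
by ring.
Qed.

Lemma semi_flat_hyperkahler :
  hyperkahler_on_W0 eps S
    (fun p => wedge (fun w => toC w.1) (fun w => etaR S p w +i* - etaI S p w))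
    (semi_flat S R).
Proof.
split.
- move=> p _ u; exact: semi_flat_linear.
- move=> p _ u v; rewrite /semi_flat; ring.
- exact: semi_flat_smooth.
- move=> p pW a pa u v; exact: semi_flat_descends.
- move=> p pW u v; exact: semi_flat_descends_2pi.
- move=> p pW v1 v2 v3; exact: semi_flat_closed.
- move=> p pW u v; exact: semi_flat_type11.
- move=> p pW v v0; exact: semi_flat_positive.
- move=> p pW v1 v2 v3 v4; exact: semi_flat_volume.
Qed.

End Hyperkahler.

Lemma hyperkahler_eq (K : realType) (eps : K) (S : plane K -> K)
    (Om Om' : wcover K -> wcover K -> wcover K -> K[i])
    (w w' : wcover K -> wcover K -> wcover K -> K) :
  (forall p, W0 eps p -> forall u v, Om p u v = Om' p u v) ->
  (forall p, W0 eps p -> forall u v, w p u v = w' p u v) ->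
  hyperkahler_on_W0 eps S Om w -> hyperkahler_on_W0 eps S Om' w'.
Proof.
move=> OmE wE [Hlin Halt Hsm Hdes Hdes2 Hcl H11 Hpos Hvol].
have oW := @open_fst K _ (plane K) _ (@open_B0 K eps).
have wEf p : W0 eps p -> w p = w' p.
  by move=> pW; apply/funext => u; apply/funext => v; exact: wE.
have OmEf p : W0 eps p -> Om p = Om' p.
  by move=> pW; apply/funext => u; apply/funext => v; exact: OmE.
split.
- by move=> p pW u k v v'; rewrite -!wE //; exact: Hlin.
- by move=> p pW u v; rewrite -!wE //; exact: Halt.
- move=> u v; apply: (smooth_eq oW) (Hsm u v) => p.
  by rewrite inE => pW; exact: wE.
- move=> p pW a pa u v; rewrite -wE // -(Hdes p pW a pa) /pullback wEf //.
- move=> p pW u v; rewrite -wE // -(Hdes2 p pW) /pullback wEf //.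
- move=> p pW v1 v2 v3; rewrite -(Hcl p pW v1 v2 v3) /d2.
  have D u v x : 'D_x (fun q => w' q u v) p = 'D_x (fun q => w q u v) p.
    apply: near_eq_derive; apply: (open_near_eq oW) pW => q; rewrite inE => qW.
    exact/esym/wE.
  by rewrite !D.
- by move=> p pW u v; rewrite -!wE //; exact: H11.
- by move=> p pW v v0; rewrite -wE //; exact: Hpos.
- by move=> p pW v1 v2 v3 v4; rewrite -wEf // -OmEf //; exact: Hvol.
Qed.

Theorem proposition5p3 (K : realType) (eps : K) (heps : 0 < eps < 1)
  (S : plane K -> K) (S_smooth : smooth_on setT S) (S0 : S (0, 0) = 0)
  (S_harmonic : harmonic_on (B eps) S)
  (St : plane K -> K) (St_conj : harmonic_conjugate_on (B eps) S St)
  (arg : plane K -> plane K -> K)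
  (arg_local : forall c0, B0 eps c0 -> arg_branch c0 (arg c0))
  (Omega : wcover K -> wcover K -> wcover K -> K[i])
  (Omega_z : forall p, W0 eps p ->
    forall u v, Omega p u v = wedge (dC z1 p) (dC z2 p) u v)
  (Omega_compatible : forall p, W0 eps p -> angles_defined S p.1 ->
    forall u v, Omega p u v = Omega_coord S St arg p u v)
  (R : K) (hR : 0 < R) :
  ((forall c, B0 eps c -> angles_defined S c) /\
   hyperkahler_on_W0 eps S Omega (omega_sf R S St arg))
  <->
  (forall c, B0 eps c -> ln (cabs c) < pd1 S c).
Proof.
have wE p : W0 eps p -> period1 S p.1 != 0 -> forall u v,
    omega_sf R S St arg p u v = semi_flat S R p u v.
  by move=> pW P0 u v; apply: (omega_sfE S_smooth S_harmonic St_conj arg_local);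
    first exact: lt0r_neq0.
split=> [[angles [_ _ _ _ _ _ _ pos _]] c cB | P_gt0].
  have P0 : period1 S c != 0 by rewrite subr_eq0; apply/eqP/angles.
  have v0 : (((1, 0), (0, 0)) : wcover K) != 0.
    by apply/eqP => -[/eqP]; rewrite oner_eq0.
  have := pos (c, (0, 0)) cB _ v0.
  rewrite wE // semi_flat_Jau /etaR /etaI /=.
  rewrite !mul0r !subr0 !expr0n expr1n /= !addr0 mulr0 mulr1 addr0.
  by rewrite pmulr_rgt0 // subr_gt0.
have P0 c : B0 eps c -> 0 < period1 S c by move=> /P_gt0; rewrite subr_gt0.
have angles c : B0 eps c -> angles_defined S c.
  by move=> /P_gt0 + E; rewrite E ltxx.
split; first exact: angles.
have H := semi_flat_hyperkahler S_smooth S_harmonic hR P0.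
refine (hyperkahler_eq _ _ H).
  move=> p pW u v; apply/esym; rewrite (Omega_compatible p pW (angles p.1 pW)).
  by rewrite (Omega_coordE S_smooth S_harmonic St_conj arg_local) // gt_eqF ?P0.
by move=> p pW u v; rewrite wE // gt_eqF ?P0.
Qed.
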